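(* Let $\mathcal W$ be a set of treatments, $(Y_t(w))_{w\in\mathcal W}$ i.i.d. over $t$, $W_t$ drawn with conditional law $P_{t-1}$ given $H^{t-1}=\{(Y_s,W_s):s<t\}$ that is a known function of $H^{t-1}$ (and does not depend on current or future potential outcomes), $Y_t=Y_t(W_t)$, $m(w)=\mathbb E[Y_t(w)]$; assume $\mathrm{Var}(Y_t(w))$ bounded above and away from zero and $\mathbb E|Y_t(w)|^{2+\delta}$ bounded, uniformly in $w$. Let $\psi$ be a linear functional continuous on each $L_2(P_{t-1})$ with Riesz representers $\gamma_t$ ($\mathbb E_{t-1}[\gamma_t f]=\psi(f)$ for $f\in L_2(P_{t-1})$) satisfying $\mathbb E_{t-1}[\gamma_t^2]>b>0$. Suppose that for some $\delta>0$, $\alpha\in[0,\delta/(2+\delta))$ and constants $C,C'>0$, $$\frac{\mathbb E_{t-1}[|\gamma_t|^{2+\delta}]}{\mathbb E_{t-1}[\gamma_t^2]^{2+\delta}}\le C\quad\text{and}\quad\mathbb E_{t-1}[\gamma_t^2]\le C't^\alpha\quad\text{for all }t.$$ For each horizon $T$ let $\lambda_t$, $t=1,\dots,T$, be $H^{t-1}$-measurable allocation rates with $\lambda_t<1$ for $t<T$, $\lambda_T=1$, and for some $C''>0$ $$\frac1{1+T-t}\le\lambda_t\le C''\frac{\mathbb E_{t-1}[\gamma_t^2]^{-1}}{t^{-\alpha}+T^{1-\alpha}-t^{1-\alpha}}.$$ Define $h_t\ge0$ by the recursion $h_t^2\,\mathbb E_{t-1}[\gamma_t^2]=\big(1-\sum_{s=1}^{t-1}h_s^2\,\mathbb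 E_{s-1}[\gamma_s^2]\big)\lambda_t$. Then, as $T\to\infty$: (A1) $\big(\sum_{t=1}^T h_t\big)^2/\mathbb E\big[\sum_{t=1}^T h_t^2\gamma_t^2\big]\to\infty$ in probability; (A2) for some $p>1$, $\sum_{t=1}^T h_t^2\mathbb E_{t-1}[\gamma_t^2]/\mathbb E\big[\sum_{t=1}^T h_t^2\gamma_t^2\big]\to1$ in $L_p$; (A3) $\sum_{t=1}^T h_t^{2+\delta}\mathbb E_{t-1}[|\gamma_t|^{2+\delta}]/\mathbb E\big[\sum_{t=1}^T h_t^2\gamma_t^2\big]^{1+\delta/2}\to0$ in probability.
   Context: $\mathbb E_{t-1}$ is conditional expectation given $H^{t-1}$; $\gamma_t$ inside expectations means $\gamma_t(W_t)$, with $\gamma_t=\gamma(\cdot;H^{t-1})$. $L_2(P_{t-1})$ is the space of functions $f$ with $\mathbb E_{t-1}[f(W_t)^2]<\infty$; continuity of $\psi$ means $|\psi(f)|\le c_{t-1}(\mathbb E_{t-1}[f(W_t)^2])^{1/2}$ for some $c_{t-1}$. *)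

(* Defs.v *)
From HB Require Import structures.
From mathcomp Require Import all_boot all_order all_algebra.
From mathcomp Require Import all_classical all_reals all_analysis.
Set Implicit Arguments. Unset Strict Implicit. Unset Printing Implicit Defensive.
Import Order.TTheory GRing.Theory Num.Theory.
Local Open Scope classical_set_scope.
Local Open Scope ring_scope.

(* A family of sub-sigma-algebras of the ambient sigma-algebra of Omega,
   increasing in t: F t = information (history H^t) available after round t. *)
Definition filtration d (Omega : measurableType d) (F : nat -> set (set Omega)) :=
  (forall t, sigma_algebra setT (F t)) /\
  (forall t, F t `<=` measurable) /\
  (forall t, F t `<=` F t.+1).

Definition measurable_wrt d (Omega : measurableType d) d' (T : measurableType d')
  (G : set (set Omega)) (f : Omega -> T) :=
  forall B, measurable B -> G (f @^-1` B).

Definition prod_sigma d (Omega : measurableType d) d' (W : measurableType d')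
  (G : set (set Omega)) : set (set (Omega * W)) :=
  <<s [set X | exists A B, G A /\ measurable B /\ X = A `*` B] >>.

Definition cond_law d (Omega : measurableType d) d' (W : measurableType d')
  (R : realType) (Pr : probability Omega R) (G : set (set Omega))
  (Wt : Omega -> W) (Pc : Omega -> probability W R) :=
  (forall A, measurable A -> measurable_wrt G (fun w => fine (Pc w A))) /\
  forall A B, measurable A -> G B ->
    (Pr (B `&` Wt @^-1` A) = \int[Pr]_(w in B) Pc w A)%E.

Definition cvg_in_prob d (Omega : measurableType d) (R : realType)
  (Pr : probability Omega R) (X : nat -> Omega -> R) (l : R) :=
  forall eps : R, 0 < eps ->
    (fun T => Pr [set w | eps <= `|X T w - l|]) @ \oo --> 0%E.

Definition cvg_in_prob_infty d (Omega : measurableType d) (R : realType)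
  (Pr : probability Omega R) (X : nat -> Omega -> R) :=
  forall M : R, (fun T => Pr [set w | X T w <= M]) @ \oo --> 0%E.

Definition cvg_in_Lp d (Omega : measurableType d) (R : realType)
  (Pr : probability Omega R) (p : R) (X : nat -> Omega -> R) (l : R) :=
  (fun T => (\int[Pr]_w ((`|X T w - l|) `^ p)%:E)%E) @ \oo --> 0%E.

(* integral of a real function against a probability measure on W
   (used for the conditional moments E_{t-1}[f(W_t)] = \int f dP_{t-1}) *)
Definition Ecm d' (W : measurableType d') (R : realType)
  (Q : probability W R) (f : W -> R) : \bar R := (\int[Q]_w (f w)%:E)%E.

(* Main.v *)
Require Import Defs.
From HB Require Import structures.
From mathcomp Require Import all_boot all_order all_algebra.
From mathcomp Require Import ring lra zify.
From mathcomp Require Import all_classical all_reals all_analysis measurable_realfun giry.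
Set Implicit Arguments. Unset Strict Implicit. Unset Printing Implicit Defensive.
Import Order.TTheory GRing.Theory Num.Theory.
Local Open Scope classical_set_scope.
Local Open Scope ring_scope.

(** Write a = alpha, g_t = E_{t-1}[gamma_t^2], q_t = h_t^2 g_t and
    r_t = 1 - \sum_(s < t) q_s.
    The recursion gives r_(t+1) = r_t (1 - lambda_t), so lambda_T = 1 forces
    \sum_t q_t = 1 surely.  Disintegrating the law of (H^(t-1), W_t) along the
    conditional law turns the normalisation E[\sum_t h_t^2 gamma_t^2] into
    E[\sum_t q_t] = 1, which is (A2) with an exact equality.

    The lower bound on the rates yields r_t <= (1 + T - t) / T.  Since
    y^(1-a) - x^(1-a) >= (1-a) y^(-a) (y - x) by Young's inequality, the upper
    bound on the rates then yields the sure estimate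
    (h_t g_t)^2 = q_t g_t <= B := C'' / (1-a) * T^(a-1).  It gives
    1 = \sum_t h_t (h_t g_t) <= sqrt B \sum_t h_t, hence (A1), and, with the
    moment condition, bounds the sum in (A3) by C T B^(1 + delta/2), whose
    exponent of T is negative exactly when a < delta / (2 + delta).  *)

(** * Disintegration of a joint law along a kernel *)

Section disintegration.
Context (R : realType) (d d' : measure_display) (X : measurableType d)
  (W : measurableType d').

(* [giry] is the type of subprobability measures; the joint law of X and a draw
   from the kernel k is the Giry bind of x |-> dirac x \x k x. *)
Lemma measurable_dirac_prod (k : X -> giry W R) :
  measurable_fun [set: X] k ->
  measurable_fun [set: X]
    (fun x => giry_prod ((dirac x : giry X R), k x) : giry (X * W)%type R).
Proof.
move=> mk.
apply: (measurableT_comp measurable_giry_prod).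
apply/measurable_fun_pairP; split => //=.
exact: measurable_giry_ret.
Qed.

(** The Giry bind of [mu] with x |-> dirac x \x k x integrates as the iterated integral. It agrees
    with [nu] on measurable rectangles, a generating pi-system, hence everywhere. *)
Lemma ge0_integral_disintegration (mu : giry X R) (k : X -> giry W R)
    (nu : giry (X * W)%type R) (f : X * W -> \bar R) :
  measurable_fun [set: X] k ->
  (forall A B, measurable A -> measurable B ->
    nu (A `*` B) = (\int[mu]_(x in A) k x B)%E) ->
  measurable_fun [set: X * W] f -> (forall p, 0 <= f p)%E ->
  (\int[nu]_p f p = \int[mu]_x \int[k x]_w f (x, w))%E.
Proof.
move=> mk nuE mf f0.
have mdk := measurable_dirac_prod mk.
have bindE (g : X * W -> \bar R) : measurable_fun setT g ->
    (forall p, 0 <= g p)%E ->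
    giry_int (giry_bind mu mdk) g = (\int[mu]_x \int[k x]_w g (x, w))%E.
  move=> mg g0; rewrite giry_int_bind//.
  apply: eq_integral => x _.
  rewrite giry_int_prod1// /giry_int integral_dirac ?diracT ?mul1e//.
  exact: measurable_fun_fubini_tonelli_F.
rewrite -bindE//; apply: eq_measure_integral => C mC _.
pose rect := [set A `*` B | A in @measurable _ X & B in @measurable _ W].
apply: (@measure_unique _ _ _ rect (fun=> setT)) => //.
- exact: measurable_prod_measurableType.
- move=> _ _ [A1 mA1 [B1 mB1 <-]] [A2 mA2 [B2 mB2 <-]].
  exists (A1 `&` A2); first exact: measurableI.
  by exists (B1 `&` B2); [exact: measurableI | rewrite setXI].
- by move=> _; exists setT => //; exists setT => //; rewrite setXTT.
- by rewrite bigcup_const.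
- move=> _ [A mA [B mB <-]].
  have mAB : measurable (A `*` B) by exact: measurableX.
  (* Testing [bindE] on the indicator of a rectangle computes the bind measure of that rectangle. *)
  have := bindE (EFin \o \1_(A `*` B)).
  rewrite /giry_int integral_indic// setIT => ->; last 2 first.
  + exact/measurable_EFinP.
  + by move=> p; rewrite lee_fin.
  transitivity (\int[mu]_(x in A) k x B)%E; first exact: nuE.
  rewrite integral_mkcond; apply: eq_integral => x _.
  rewrite patchE; case: ifPn => xA.
  + rewrite -[in LHS](setIT B) -integral_indic//; apply: eq_integral => w _ /=.
    by rewrite !indicE in_setX xA.
  + by rewrite integral0_eq// => w _ /=; rewrite indicE in_setX (negbTE xA).
- move=> _; rewrite -ge0_fin_numE //; exact: fin_num_measure.
Qed.

End disintegration.

(** * Conditional laws given a sub-sigma-algebra *)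

Section conditional_law.
Context (R : realType) (d d' : measure_display) (Omega : measurableType d)
  (W : measurableType d').
Implicit Types (G : set (set Omega)).

Lemma measurable_wrtP G d2 (T : measurableType d2) (f : Omega -> T) :
  sigma_algebra setT G ->
  measurable_wrt G f <->
  measurable_fun [set: g_sigma_algebraType G] (f : g_sigma_algebraType G -> T).
Proof.
move=> sG; split.
  move=> mf _ B mB; rewrite setTI; apply: sub_sigma_algebra; exact: mf.
move=> mf B mB; have := mf measurableT B mB.
by rewrite setTI measurable_g_measurableTypeE.
Qed.

Lemma prod_sigmaE G : sigma_algebra setT G ->
  prod_sigma (W := W) G =
  @measurable _ (g_sigma_algebraType G * W)%type.
Proof.
move=> sG; rewrite measurable_prod_measurableType /prod_sigma.
congr (<<s _ >>); apply/seteqP; split => [_ [A [B [GA [mB ->]]]]|].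
  by exists A; [exact: sub_sigma_algebra | exists B].
move=> _ [A mA [B mB <-]]; exists A, B; split => //.
by rewrite -(measurable_g_measurableTypeE sG).
Qed.

Lemma measurable_wrt_prodP G d2 (T : measurableType d2) (f : Omega * W -> T) :
  sigma_algebra setT G ->
  measurable_wrt (prod_sigma (W := W) G) f <->
  measurable_fun [set: g_sigma_algebraType G * W]
    (f : g_sigma_algebraType G * W -> T).
Proof.
move=> sG; rewrite /measurable_wrt prod_sigmaE//; split.
  by move=> mf _ B mB; rewrite setTI; exact: mf.
by move=> mf B mB; have := mf measurableT B mB; rewrite setTI.
Qed.

Variables (Pr : probability Omega R) (G : set (set Omega)).
Hypotheses (sG : sigma_algebra setT G) (GM : G `<=` measurable).
Variables (Wt : Omega -> W) (Pc : Omega -> probability W R).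
Hypotheses (Pcond : cond_law Pr G Wt Pc).

(* Working over Omega equipped with the smaller sigma-algebra G makes Pc a kernel
   and [prod_sigma G] a product sigma-algebra. *)
Let OG : measurableType _ := g_sigma_algebraType G.
Let k : OG -> giry W R := Pc.

Let mk : measurable_fun [set: OG] k.
Proof.
apply: measurable_giry_codensity => // B mB.
rewrite (_ : (k ^~ B) = (fun x => (fine (Pc x B))%:E)); last first.
  by apply/funext => x; rewrite fineK// fin_num_measure.
by apply/measurable_EFinP/(measurable_wrtP _ sG); exact: Pcond.1.
Qed.

(** The inner integral is the integral of f against dirac x \x Pc x: a measurable kernel followed by
    the measurable map [giry_int]. *)
Lemma measurable_cond_integral (f : OG * W -> \bar R) :
  measurable_fun [set: OG * W] f -> (forall p, 0 <= f p)%E ->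
  measurable_fun [set: OG] (fun x => \int[Pc x]_w f (x, w))%E.
Proof.
move=> mf f0.
have mdk := measurable_dirac_prod mk.
have := measurableT_comp (measurable_giry_int mf f0) mdk.
congr measurable_fun; apply/funext => x /=.
rewrite giry_int_prod1// /giry_int integral_dirac ?diracT ?mul1e//.
exact: measurable_fun_fubini_tonelli_F.
Qed.

Let mid_sub : measurable_fun [set: Omega] (fun x => x : OG).
Proof.
move=> _ A; rewrite /OG measurable_g_measurableTypeE// => GA.
by rewrite setTI; exact: GM.
Qed.

Let mgraph : measurable_fun setT Wt ->
  measurable_fun [set: Omega] (fun x => (x, Wt x) : OG * W).
Proof. by move=> mW; apply/measurable_fun_pairP; split. Qed.

(** Disintegration with [mu] the restriction of [Pr] to G and [nu] the law of (x, Wt x), both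
    pushforwards of [Pr]. The rectangle formula is then the defining property in [cond_law]. *)
Lemma integral_cond_law (f : OG * W -> \bar R) : measurable_fun setT Wt ->
  measurable_fun [set: OG * W] f -> (forall p, 0 <= f p)%E ->
  (\int[Pr]_x f (x, Wt x) = \int[Pr]_x \int[Pc x]_w f (x, w))%E.
Proof.
move=> mW mf f0.
have h := ge0_integral_disintegration (mu := giry_map mid_sub (Pr : giry Omega R))
  (nu := giry_map (mgraph mW) (Pr : giry Omega R)) mk _ mf f0.
transitivity (giry_int (giry_map (mgraph mW) (Pr : giry Omega R)) f).
  by rewrite giry_int_map.
rewrite /giry_int h; last first.
  move=> A B mA mB.
  have GA : G A by rewrite -(measurable_g_measurableTypeE sG).
  rewrite [RHS](@ge0_integral_pushforward _ _ _ _ _ _ mid_sub)//.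
  - by rewrite -[RHS](Pcond.2 B A).
  - exact: measurable_funTS (measurableT_comp (measurable_giry_ev mB) mk).
rewrite -[LHS]/(giry_int _ _) giry_int_map//.
  exact: measurable_cond_integral.
by move=> x; exact: integral_ge0.
Qed.

Lemma measurable_at_draw d2 (T : measurableType d2) (f : OG * W -> T) :
  measurable_fun setT Wt -> measurable_fun [set: OG * W] f ->
  measurable_fun [set: Omega] (fun x => f (x, Wt x)).
Proof. by move=> mW mf; apply: (measurableT_comp mf); exact: mgraph. Qed.

Variables (c : Omega -> R) (gam : Omega -> W -> R).
Hypothesis mgam : measurable_wrt (prod_sigma (W := W) G) (fun p => gam p.1 p.2).
Hypothesis gam_fin : forall x, Ecm (Pc x) (fun w => gam x w ^+ 2) \is a fin_num.

Let mgam2 : measurable_fun [set: OG * W] (fun p => gam p.1 p.2 ^+ 2).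
Proof. by apply: measurable_funX; exact/measurable_wrt_prodP. Qed.

Lemma measurable_cond_second_moment :
  measurable_wrt G (fun x => fine (Ecm (Pc x) (fun w => gam x w ^+ 2))).
Proof.
apply/measurable_wrtP => //; apply/measurable_EFinP.
have := @measurable_cond_integral (fun p => (gam p.1 p.2 ^+ 2)%:E).
have -> : EFin \o (fun x => fine (Ecm (Pc x) (fun w => gam x w ^+ 2))) =
    (fun x => \int[Pc x]_w (gam x w ^+ 2)%:E)%E.
  by apply/funext => x /=; rewrite fineK.
apply; first exact/measurable_EFinP.
by move=> p; rewrite lee_fin sqr_ge0.
Qed.

Hypotheses (mW : measurable_fun setT Wt) (c0 : forall x, 0 <= c x)
  (mc : measurable_wrt G c).

Let mcgam2 : measurable_fun [set: OG * W] (fun p => c p.1 * gam p.1 p.2 ^+ 2).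
Proof.
apply: measurable_funM => //.
exact: (measurableT_comp (proj1 (measurable_wrtP c sG) mc)).
Qed.

Lemma measurable_weighted_draw :
  measurable_fun [set: Omega] (fun x => c x * gam x (Wt x) ^+ 2).
Proof. exact: (measurable_at_draw mW mcgam2). Qed.

(** Tower property: the G-measurable weight c is constant in the drawn variable and leaves the inner
    integral. *)
Lemma integral_weighted_draw :
  (\int[Pr]_x (c x * gam x (Wt x) ^+ 2)%:E =
   \int[Pr]_x (c x * fine (Ecm (Pc x) (fun w => gam x w ^+ 2)))%:E)%E.
Proof.
rewrite (@integral_cond_law (fun p => (c p.1 * gam p.1 p.2 ^+ 2)%:E)) //=.
- apply: eq_integral => x _; under eq_integral do rewrite EFinM.
  rewrite ge0_integralZl_EFin//.
  + by rewrite EFinM fineK.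
  + by move=> w _; rewrite lee_fin sqr_ge0.
  + apply/measurable_EFinP; exact: (measurable_fun_pair2 (x : OG) mgam2).
- exact/measurable_EFinP.
- by move=> p; rewrite lee_fin mulr_ge0// sqr_ge0.
Qed.

End conditional_law.

(** * Pathwise bounds at a fixed horizon *)

Section deterministic_bounds.
Context (R : realType).

(** Tangent-line inequality for the concave power 1 - a at y. Multiplied by y^a it becomes Young's
    inequality for x^(1-a) y^a. *)
Lemma powR_subr_ge (a x y : R) : 0 <= a -> a < 1 -> 0 <= x -> 0 < y ->
  (1 - a) * y `^ (- a) * (y - x) <= y `^ (1 - a) - x `^ (1 - a).
Proof.
move=> a0 a1 x0 y0.
have ya0 : 0 < y `^ a by rewrite powR_gt0.
have yya : y `^ (1 - a) = y * (y `^ a)^-1.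
  by rewrite powRB ?(gt_eqF y0) ?implybT// powRr1// ltW.
have young : x `^ (1 - a) * y `^ a <= (1 - a) * x + a * y.
  (* The conjugate exponents are 1/(1-a) and 1/a, so a = 0 is treated apart. *)
  have [->|an0] := eqVneq a 0.
    by rewrite subr0 powRr0 mulr1 powRr1// mul1r mul0r addr0.
  have a'0 : 0 < a by rewrite lt_neqAle eq_sym an0.
  have b0 : 0 < 1 - a by rewrite subr_gt0.
  have := @conjugate_powR R (x `^ (1 - a)) (y `^ a) (1 - a)^-1 a^-1
    (powR_ge0 _ _) (ltW ya0).
  rewrite !invr_gt0 !invrK subrK => /(_ b0 a'0 erefl).
  rewrite -!powRrM !divff ?gt_eqF// !powRr1 ?(ltW y0)//.
  by rewrite ![_ * (1 - a)]mulrC [y * a]mulrC.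
rewrite powRN yya -(ler_pM2r ya0) [leRHS]mulrBl.
rewrite -[y / _ * _]mulrA mulVf ?gt_eqF// mulr1.
rewrite -!mulrA [_^-1 * _]mulrC -!mulrA divff ?gt_eqF//.
lra.
Qed.

Lemma powR_pinfty (c M : R) : 0 < c ->
  \forall n \near \oo, M <= (n%:R : R) `^ c.
Proof.
move=> c0; near=> n.
(* The maximum with 1 has a c-th root even when M is negative. *)
apply: (@le_trans _ _ (Num.max M 1)); first by rewrite le_max lexx.
have M0 : 0 <= Num.max M 1 by rewrite le_max ler01 orbT.
have -> : Num.max M 1 = (Num.max M 1 `^ c^-1) `^ c.
  by rewrite -powRrM mulVf ?gt_eqF// powRr1.
apply: ge0_ler_powR; rewrite ?nnegrE ?powR_ge0 ?ler0n ?(ltW c0)//.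
by near: n; exact: nbhs_infty_ger.
Unshelve. all: by end_near. Qed.

Variables (T : nat) (g lam h : nat -> R) (alpha C : R).
Hypotheses (T0 : (0 < T)%N) (alpha0 : 0 <= alpha) (alpha1 : alpha < 1)
  (C0 : 0 < C).
Hypothesis g_gt0 : forall t, (1 <= t <= T)%N -> 0 < g t.
Hypothesis lam_lt1 : forall t, (1 <= t < T)%N -> lam t < 1.
Hypothesis lam_last : lam T = 1.
Hypothesis lam_ge : forall t, (1 <= t <= T)%N -> 1 / (1 + T - t)%N%:R <= lam t.
Hypothesis lam_le : forall t, (1 <= t <= T)%N -> lam t <= C * (g t)^-1 /
  (t%:R `^ (- alpha) + T%:R `^ (1 - alpha) - t%:R `^ (1 - alpha)).
Hypothesis h_ge0 : forall t, (1 <= t <= T)%N -> 0 <= h t.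
Hypothesis hE : forall t, (1 <= t <= T)%N ->
  h t ^+ 2 * g t = (1 - \sum_(1 <= s < t) h s ^+ 2 * g s) * lam t.

Let r t := 1 - \sum_(1 <= s < t) h s ^+ 2 * g s.
Let B := C / (1 - alpha) / T%:R `^ (1 - alpha).

Let r_rec t : (1 <= t <= T)%N -> r t.+1 = r t * (1 - lam t).
Proof.
move=> tT; have /andP[t1 _] := tT.
rewrite /r big_nat_recr//= hE// mulrBr mulr1 opprD addrA.
by rewrite -/(r t).
Qed.

(** Each round multiplies r by at most 1 - 1/(1+T-t) = (T-t)/(1+T-t), and these factors
    telescope. *)
Let r_bounds t : (1 <= t <= T)%N -> 0 <= r t <= (1 + T - t)%N%:R / T%:R.
Proof.
elim: t => // -[_ _|t IH tT].
  by rewrite /r big_geq// subr0 ler01 add1n subn1 /= divff// pnatr_eq0 -lt0n.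
have tT' : (1 <= t.+1 < T)%N by [].
have tT2 : (1 <= t.+1 <= T)%N by exact: ltnW.
have /andP[r0 r1] := IH tT2.
rewrite r_rec//.
have l1 := lam_lt1 tT'.
have l2 := lam_ge tT2.
have N0 : 0 < (1 + T - t.+1)%N%:R :> R by rewrite ltr0n; lia.
rewrite mulr_ge0//=; last by rewrite subr_ge0 ltW.
apply: (@le_trans _ _ ((1 + T - t.+1)%N%:R / T%:R *
    (1 - 1 / (1 + T - t.+1)%N%:R))).
  by apply: ler_pM => //; [rewrite subr_ge0 ltW | rewrite lerD2l lerN2].
have -> : (1 + T - t.+1)%N = (1 + T - t.+2).+1 by lia.
rewrite -natr1.
have u0 : 0 <= (1 + T - t.+2)%N%:R :> R by [].
have v0 : 0 < T%:R :> R by rewrite ltr0n.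
rewrite le_eqVlt; apply/orP; left; apply/eqP; field.
by rewrite !gt_eqF// ltr_wpDl.
Qed.

Lemma sum_weights_eq1 : \sum_(1 <= t < T.+1) h t ^+ 2 * g t = 1.
Proof.
have : r T.+1 = 0 by rewrite r_rec ?T0 ?leqnn// lam_last subrr mulr0.
by move/eqP; rewrite subr_eq0 => /eqP.
Qed.

(** The square equals r_t times lambda_t g_t. The factor 1+T-t in the bound on r_t cancels against
    the one in the lower bound on the denominator of the rate. *)
Lemma weight_sqr_le t : (1 <= t <= T)%N -> (h t * g t) ^+ 2 <= B.
Proof.
move=> tT; have /andP[t1 tT1] := tT.
have g0 := g_gt0 tT.
have T0' : 0 < T%:R :> R by rewrite ltr0n.
have t0 : 0 < t%:R :> R by rewrite ltr0n.
have N0 : 0 < (1 + T - t)%N%:R :> R by rewrite ltr0n; lia.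
have b0 : 0 < 1 - alpha by rewrite subr_gt0.
have Ta0 : 0 < T%:R `^ alpha :> R by rewrite powR_gt0.
set den := t%:R `^ (- alpha) + T%:R `^ (1 - alpha) - t%:R `^ (1 - alpha).
(* Split 1+T-t: [powR_subr_ge] at T and t pays for T-t, and t^(-alpha) >= T^(-alpha) pays for the
   1. *)
have den_ge : (1 - alpha) / T%:R `^ alpha * (1 + T - t)%N%:R <= den.
  have tT_a : (T%:R `^ alpha)^-1 <= t%:R `^ (- alpha).
    rewrite powRN lef_pV2 ?posrE ?powR_gt0//.
    by apply: ge0_ler_powR; rewrite ?nnegrE ?ler0n ?ler_nat.
  have := powR_subr_ge alpha0 alpha1 (ltW t0) T0'.
  rewrite powRN => yg.
  rewrite -addnBA// natrD natrB// mulrDr mulr1 /den -addrA.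
  apply: lerD => //; apply: le_trans tT_a.
  by rewrite ler_piMl ?invr_ge0 ?powR_ge0// lerBlDl lerDr.
have low0 : 0 < (1 - alpha) / T%:R `^ alpha * (1 + T - t)%N%:R.
  by rewrite !mulr_gt0// invr_gt0.
have den0 := lt_le_trans low0 den_ge.
have /andP[r0 r1] := r_bounds tT.
have -> : (h t * g t) ^+ 2 = r t * (lam t * g t).
  by rewrite exprMn [g t ^+ 2]expr2 mulrA hE// -mulrA.
apply: (@le_trans _ _ ((1 + T - t)%N%:R / T%:R *
    (C / ((1 - alpha) / T%:R `^ alpha * (1 + T - t)%N%:R)))).
  have l0 : 0 <= lam t by apply: le_trans (lam_ge tT); rewrite divr_ge0.
  apply: ler_pM => //; first by rewrite mulr_ge0// ltW.
  apply: (@le_trans _ _ (C / den)).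
    rewrite -ler_pdivlMr//; apply: le_trans (lam_le tT) _.
    by rewrite -/den mulrAC.
  by rewrite ler_pM2l// lef_pV2.
rewrite /B powRB ?(gt_eqF T0') ?implybT// powRr1 ?(ltW T0')//.
rewrite le_eqVlt; apply/orP; left; apply/eqP; field.
by rewrite !gt_eqF.
Qed.

Let B_gt0 : 0 < B.
Proof. by rewrite !divr_gt0 ?powR_gt0 ?subr_gt0// ltr0n. Qed.

Lemma sum_sqrt_weights_ge :
  T%:R `^ (1 - alpha) / (C / (1 - alpha)) <= (\sum_(1 <= t < T.+1) h t) ^+ 2.
Proof.
set S := \sum_(_ <= _ < _) _.
have -> : T%:R `^ (1 - alpha) / (C / (1 - alpha)) = B^-1 by rewrite /B [RHS]invf_div.
have S0 : 0 <= S by rewrite /S big_nat sumr_ge0// => t /h_ge0.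
have sB : 0 < Num.sqrt B by rewrite sqrtr_gt0.
have : 1 <= S * Num.sqrt B.
  rewrite -sum_weights_eq1 /S mulr_suml big_nat [leRHS]big_nat.
  apply: ler_sum => t tT; rewrite expr2 -mulrA ler_wpM2l ?h_ge0//.
  have hg0 : 0 <= h t * g t by rewrite mulr_ge0 ?h_ge0// ltW ?g_gt0.
  by rewrite -(ger0_norm hg0) -sqrtr_sqr ler_wsqrtr// weight_sqr_le.
rewrite -ler_pdivrMr// => h1.
have -> : B^-1 = (1 / Num.sqrt B) ^+ 2.
  by rewrite expr_div_n expr1n sqr_sqrtr ?(ltW B_gt0)// mul1r.
by rewrite lerXn2r// nnegrE divr_ge0// ltW.
Qed.

Lemma sum_weighted_moments_le (delta D : R) (m : nat -> R) :
  0 <= delta -> 0 <= D ->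
  (forall t, (1 <= t <= T)%N -> m t <= D * g t `^ (2 + delta)) ->
  \sum_(1 <= t < T.+1) h t `^ (2 + delta) * m t <=
  D * (C / (1 - alpha)) `^ (1 + delta / 2) /
    T%:R `^ ((1 - alpha) * (1 + delta / 2) - 1).
Proof.
move=> d0 D0 mle.
have T0' : 0 < T%:R :> R by rewrite ltr0n.
have e0 : 0 <= 1 + delta / 2 by rewrite addr_ge0// divr_ge0.
have b0 : 0 < 1 - alpha by rewrite subr_gt0.
apply: (@le_trans _ _ (\sum_(1 <= t < T.+1) D * B `^ (1 + delta / 2))).
  rewrite big_nat [leRHS]big_nat; apply: ler_sum => t tT.
  have hg0 : 0 <= h t * g t by rewrite mulr_ge0 ?h_ge0// ltW ?g_gt0.
  apply: (@le_trans _ _ (h t `^ (2 + delta) * (D * g t `^ (2 + delta)))).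
    by rewrite ler_wpM2l ?powR_ge0// mle.
  rewrite mulrCA ler_wpM2l// -powRM ?h_ge0 ?(ltW (g_gt0 tT))//.
  (* This exposes the square h_t g_t, which [weight_sqr_le] bounds. *)
  have -> : 2 + delta = 2%:R * (1 + delta / 2) by field.
  rewrite powRrM powR_mulrn//.
  by apply: ge0_ler_powR; rewrite ?nnegrE ?sqr_ge0 ?(ltW B_gt0)// weight_sqr_le.
(* There are T equal terms; their number accounts for the -1 in the exponent of T. *)
rewrite big_const_nat subn1 /= iter_addr_0 -[leLHS]mulr_natr -!mulrA ler_wpM2l//.
rewrite /B powRM ?invr_ge0 ?powR_ge0 ?divr_ge0 ?(ltW C0) ?(ltW b0)// -mulrA ler_wpM2l ?powR_ge0//.
rewrite -powRN -powRrM -{2}[T%:R]powRr1 ?ler0n// -powRD ?(gt_eqF T0') ?implybT//.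
by rewrite mulNr -powRN opprB addrC.
Qed.

End deterministic_bounds.

(** * Expectation of the weighted sum along the filtration *)

Lemma measurable_wrtS d (Omega : measurableType d) d' (T : measurableType d')
    (G H : set (set Omega)) (f : Omega -> T) :
  G `<=` H -> measurable_wrt G f -> measurable_wrt H f.
Proof. by move=> GH mf B /mf /GH. Qed.

Lemma filtrationS d (Omega : measurableType d) (F : nat -> set (set Omega))
    (s t : nat) : filtration F -> (s <= t)%N -> F s `<=` F t.
Proof.
move=> [_ [_ Fmono]]; elim: t => [|t IH]; first by rewrite leqn0 => /eqP ->.
rewrite leq_eqVlt => /predU1P[-> //|st].
exact: subset_trans (IH st) (Fmono t).
Qed.

Section expected_weighted_sum.
Context (R : realType) (d d' : measure_display) (Omega : measurableType d)
  (W : measurableType d') (Pr : probability Omega R)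
  (F : nat -> set (set Omega)) (Wt : nat -> Omega -> W)
  (P : nat -> Omega -> probability W R) (gamma : nat -> Omega -> W -> R).
Hypotheses (filtF : filtration F)
  (WtF : forall t, (1 <= t)%N -> measurable_wrt (F t) (Wt t))
  (WtP : forall t, (1 <= t)%N -> cond_law Pr (F t.-1) (Wt t) (P t))
  (mgamma : forall t, (1 <= t)%N ->
    measurable_wrt (prod_sigma (W := W) (F t.-1)) (fun p => gamma t p.1 p.2)).

Let g t x := fine (Ecm (P t x) (fun w => gamma t x w ^+ 2)).

Hypotheses (gamma_fin : forall t x, (1 <= t)%N ->
    Ecm (P t x) (fun w => gamma t x w ^+ 2) \is a fin_num)
  (g_gt0 : forall t x, (1 <= t)%N -> 0 < g t x).
Variables (T : nat) (lam h : nat -> Omega -> R).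
Hypotheses (T0 : (0 < T)%N)
  (mlam : forall t, (1 <= t <= T)%N -> measurable_wrt (F t.-1) (lam t))
  (lam_last : forall x, lam T x = 1)
  (hE : forall t x, (1 <= t <= T)%N -> h t x ^+ 2 * g t x =
    (1 - \sum_(1 <= s < t) h s x ^+ 2 * g s x) * lam t x).

Let sF t : sigma_algebra setT (F t). Proof. exact: filtF.1. Qed.

Let mg t : (1 <= t)%N -> measurable_wrt (F t.-1) (g t).
Proof.
move=> t1; apply: (measurable_cond_second_moment (sF _) (WtP t1)).
  exact: mgamma.
by move=> x; exact: gamma_fin.
Qed.

Let r t x := 1 - \sum_(1 <= s < t) h s x ^+ 2 * g s x.

Let r_rec t x : (1 <= t <= T)%N -> r t.+1 x = r t x - r t x * lam t x.
Proof.
move=> tT; have /andP[t1 _] := tT.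
by rewrite {1}/r big_nat_recr//= hE// opprD addrA.
Qed.

(** By [r_rec], r_(t+1) is a polynomial in r_t and lambda_t, so predictability propagates without
    reference to h. *)
Let mr t : (1 <= t <= T)%N -> measurable_wrt (F t.-1) (r t).
Proof.
elim: t => // -[_ _|t IH tT].
  apply/measurable_wrtP => //.
  rewrite (_ : r 1 = cst 1)//.
  by apply/funext => x; rewrite /r big_geq// subr0.
have tT1 : (1 <= t.+1 <= T)%N by exact: ltnW.
rewrite (_ : r t.+2 = (fun x => r t.+1 x - r t.+1 x * lam t.+1 x)); last first.
  by apply/funext => x; rewrite r_rec.
apply: (@measurable_wrtS _ _ _ _ (F t)); first by case: filtF => _ [_]; exact.
have mr1 := (measurable_wrtP (r t.+1) (sF t)).1 (IH tT1).
have ml1 := (measurable_wrtP (lam t.+1) (sF t)).1 (mlam tT1).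
apply/measurable_wrtP => //.
by apply: measurable_funB => //; exact: measurable_funM.
Qed.

(** Since h is given only through its recursion, its square is recovered as r_t lambda_t / g_t, a
    combination of predictable functions. *)
Lemma measurable_weight t : (1 <= t <= T)%N ->
  measurable_wrt (F t.-1) (fun x => h t x ^+ 2).
Proof.
move=> tT; have /andP[t1 _] := tT.
rewrite (_ : (fun x => _) = (fun x => r t x * lam t x * g t x `^ (-1))).
  apply/measurable_wrtP => //; apply: measurable_funM.
    by apply: measurable_funM; apply/measurable_wrtP => //; [exact: mr|exact: mlam].
  apply: (measurableT_comp (measurable_powR _)).
  by apply/measurable_wrtP => //; exact: mg.
apply/funext => x; rewrite powR_inv1 ?ltW ?g_gt0// -hE// mulfK//.
by rewrite gt_eqF ?g_gt0.
Qed.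

Lemma integral_weighted_sum_eq1 :
  (\int[Pr]_x (\sum_(1 <= t < T.+1) h t x ^+ 2 * gamma t x (Wt t x) ^+ 2)%:E
   = 1)%E.
Proof.
(* Extended by 0 outside 1 <= t <= T because [ge0_integral_sum] asks for
   measurability and nonnegativity at every index. *)
pose c t x := if (1 <= t <= T)%N then h t x ^+ 2 else 0.
have mWt t : (1 <= t)%N -> measurable_fun setT (Wt t).
  by move=> t1 _ B mB; rewrite setTI; apply: (filtF.2.1 t); exact: WtF.
have c0 t x : 0 <= c t x by rewrite /c; case: ifP => // _; rewrite sqr_ge0.
have mc t : measurable_wrt (F t.-1) (c t).
  rewrite /c; have [tT|_] := boolP (1 <= t <= T)%N.
    exact: measurable_weight.
  by apply/measurable_wrtP.
have FM t : F t `<=` measurable by exact: filtF.2.1.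
pose a t x := if (1 <= t)%N then c t x * gamma t x (Wt t x) ^+ 2 else 0.
pose b t x := if (1 <= t)%N then c t x * g t x else 0.
have a0 t x : 0 <= a t x.
  by rewrite /a; case: ifP => // _; rewrite mulr_ge0// sqr_ge0.
have b0 t x : 0 <= b t x.
  by rewrite /b; case: ifP => // t1; rewrite mulr_ge0// ltW// g_gt0.
have ma t : measurable_fun setT (a t).
  rewrite /a; have [t1|//] := boolP (1 <= t)%N.
  by apply: (measurable_weighted_draw (sF _) (FM _) (mgamma t1) (mWt _ t1)).
have mb t : measurable_fun setT (b t).
  rewrite /b; have [t1|//] := boolP (1 <= t)%N; move=> _ B mB; rewrite setTI; apply: (FM t.-1).
  have mct := (measurable_wrtP (c t) (sF t.-1)).1 (mc t).
  have mgt := (measurable_wrtP (g t) (sF t.-1)).1 (mg t1).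
  have /measurable_wrtP := measurable_funM mct mgt.
  by apply.
have ab t : (\int[Pr]_x (a t x)%:E = \int[Pr]_x (b t x)%:E)%E.
  rewrite /a /b; have [t1|//] := boolP (1 <= t)%N.
  apply: (integral_weighted_draw (sF _) (FM _) (WtP t1) (mgamma t1)) => //.
  - by move=> x; exact: gamma_fin.
  - exact: mWt.
transitivity (\int[Pr]_x (\sum_(1 <= t < T.+1) (a t x)%:E))%E.
  apply: eq_integral => x _; rewrite sumEFin; congr EFin.
  rewrite big_nat [RHS]big_nat; apply: eq_bigr => t tT.
  by rewrite /a /c tT; case/andP: tT => ->.
rewrite ge0_integral_sum//; last 2 first.
- by move=> t; exact/measurable_EFinP.
- by move=> t x _; rewrite lee_fin.
(* Draws are replaced by conditional moments term by term; resumming under the integral then makes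
   the pathwise identity [sum_weights_eq1] applicable. *)
rewrite (eq_bigr _ (fun t _ => ab t)).
rewrite -ge0_integral_sum//; last 2 first.
- by move=> t; exact/measurable_EFinP.
- by move=> t x _; rewrite lee_fin.
transitivity (\int[Pr]_x (cst 1%E x))%E.
  apply: eq_integral => x _; rewrite sumEFin /=; congr EFin.
  rewrite -(@sum_weights_eq1 _ _ (g ^~ x) (lam ^~ x) (h ^~ x) T0)//; last first.
    by move=> t tT; rewrite hE.
  rewrite big_nat [RHS]big_nat; apply: eq_bigr => t tT.
  by rewrite /b /c tT; case/andP: tT => ->.
by rewrite integral_cst// mul1e; exact: probability_setT.
Qed.

End expected_weighted_sum.

(** * The three asymptotic conditions *)

Theorem theorem5 (R : realType) (d : measure_display) (Omega : measurableType d)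
  (d' : measure_display) (W : measurableType d')
  (Pr : probability Omega R) (F : nat -> set (set Omega))
  (Wt : nat -> Omega -> W) (P : nat -> Omega -> probability W R)
  (psi : (W -> R) -> R) (gamma : nat -> Omega -> W -> R)
  (delta alpha b C C' C'' : R)
  (lam : nat -> nat -> Omega -> R) (h : nat -> nat -> Omega -> R) :
  (* the filtration F t = sigma(H^t), W_t adapted, with conditional law
     P t = P_{t-1} given F (t-1) *)
  filtration F ->
  (forall t, (1 <= t)%N -> measurable_wrt (F t) (Wt t)) ->
  (forall t, (1 <= t)%N -> cond_law Pr (F t.-1) (Wt t) (P t)) ->
  (* psi linear, continuous on each L2(P_{t-1}) *)
  (forall (a : R) (f g : W -> R),
      psi (fun w => a * f w + g w) = a * psi f + psi g) ->
  (forall t w0, (1 <= t)%N -> exists c : R, forall f : W -> R,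
      measurable_fun setT f ->
      (Ecm (P t w0) (fun w => (f w ^+ 2)%R) < +oo)%E ->
      `|psi f| <= c * Num.sqrt (fine (Ecm (P t w0) (fun w => (f w ^+ 2)%R)))) ->
  (* gamma_t = gamma(. ; H^{t-1}) is F(t-1) (x) W measurable *)
  (forall t, (1 <= t)%N ->
      measurable_wrt (@prod_sigma _ Omega _ W (F t.-1)) (fun p => gamma t p.1 p.2)) ->
  (* Riesz representer property *)
  (forall t w0 (f : W -> R), (1 <= t)%N -> measurable_fun setT f ->
      (Ecm (P t w0) (fun w => (f w ^+ 2)%R) < +oo)%E ->
      (psi f)%:E = Ecm (P t w0) (fun w => (gamma t w0 w * f w)%R)) ->
  0 < b ->
  (forall t w0, (1 <= t)%N ->
      (b%:E < Ecm (P t w0) (fun w => (gamma t w0 w ^+ 2)%R))%E) ->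
  0 < delta -> 0 <= alpha -> alpha < delta / (2 + delta) ->
  0 < C -> 0 < C' -> 0 < C'' ->
  (forall t w0, (1 <= t)%N ->
      (Ecm (P t w0) (fun w => (`|gamma t w0 w| `^ (2 + delta))%R) <=
       ((C * (fine (Ecm (P t w0) (fun w => (gamma t w0 w ^+ 2)%R))) `^ (2 + delta))%R)%:E)%E) ->
  (forall t w0, (1 <= t)%N ->
      (Ecm (P t w0) (fun w => (gamma t w0 w ^+ 2)%R) <= (C' * t%:R `^ alpha)%R%:E)%E) ->
  (* allocation rates *)
  (forall T t, (1 <= t <= T)%N -> measurable_wrt (F t.-1) (lam T t)) ->
  (forall T t w0, (1 <= t < T)%N -> lam T t w0 < 1) ->
  (forall T w0, (1 <= T)%N -> lam T T w0 = 1) ->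
  (forall T t w0, (1 <= t <= T)%N ->
      1 / ((1 + T - t)%N)%:R <= lam T t w0 /\
      lam T t w0 <=
        C'' * (fine (Ecm (P t w0) (fun w => (gamma t w0 w ^+ 2)%R)))^-1 /
        (t%:R `^ (- alpha) + T%:R `^ (1 - alpha) - t%:R `^ (1 - alpha))) ->
  (* the weights h_t >= 0 defined by the recursion *)
  (forall T t w0, (1 <= t <= T)%N ->
      0 <= h T t w0 /\
      h T t w0 ^+ 2 * fine (Ecm (P t w0) (fun w => (gamma t w0 w ^+ 2)%R)) =
        (1 - \sum_(1 <= s < t) h T s w0 ^+ 2 *
               fine (Ecm (P s w0) (fun w => (gamma s w0 w ^+ 2)%R))) * lam T t w0) ->
  let D := fun T : nat =>
    fine (\int[Pr]_w0 (\sum_(1 <= t < T.+1)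
                          h T t w0 ^+ 2 * gamma t w0 (Wt t w0) ^+ 2)%R%:E)%E in
  (* (A1) *)
  cvg_in_prob_infty Pr
    (fun T w0 => (\sum_(1 <= t < T.+1) h T t w0) ^+ 2 / D T) /\
  (* (A2) *)
  (exists p : R, 1 < p /\
    cvg_in_Lp Pr p
      (fun T w0 => (\sum_(1 <= t < T.+1) h T t w0 ^+ 2 *
                      fine (Ecm (P t w0) (fun w => (gamma t w0 w ^+ 2)%R))) / D T) 1) /\
  (* (A3) *)
  cvg_in_prob Pr
    (fun T w0 => (\sum_(1 <= t < T.+1) h T t w0 `^ (2 + delta) *
                    fine (Ecm (P t w0) (fun w => (`|gamma t w0 w| `^ (2 + delta))%R)))
                 / (D T) `^ (1 + delta / 2)) 0.
Proof.
move=> filtF WtF WtP _ _ mgamma _ b0 gamma_gt delta0 alpha0 alpha_lt C0 C'0 C''0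
  moment_le gamma_le mlam lam_lt1 lam_last lam_bounds h_rec D.
set g := fun t w0 => fine (Ecm (P t w0) (fun w => gamma t w0 w ^+ 2)).
have gamma_fin t x : (1 <= t)%N ->
    Ecm (P t x) (fun w => gamma t x w ^+ 2) \is a fin_num.
  move=> t1; rewrite fin_real// (lt_trans (ltNyr b) (gamma_gt t x t1)).
  exact: le_lt_trans (gamma_le t x t1) (ltry _).
have g_gt0 t x : (1 <= t)%N -> 0 < g t x.
  move=> t1; apply: (lt_trans b0).
  by rewrite -lte_fin fineK ?gamma_fin// gamma_gt.
have hE T t x : (1 <= t <= T)%N -> h T t x ^+ 2 * g t x =
    (1 - \sum_(1 <= s < t) h T s x ^+ 2 * g s x) * lam T t x.
  by move=> tT; have [] := h_rec T t x tT.
have h_ge0 T t x : (1 <= t <= T)%N -> 0 <= h T t x.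
  by move=> tT; have [] := h_rec T t x tT.
have D1 T : (0 < T)%N -> D T = 1.
  move=> T0; rewrite /D (integral_weighted_sum_eq1 filtF WtF WtP mgamma gamma_fin
    g_gt0 T0 (mlam T))//.
  - by move=> x; exact: lam_last.
  - exact: hE.
have delta2 : 0 < 2 + delta by rewrite addr_gt0.
have alpha1 : alpha < 1.
  by apply: (lt_trans alpha_lt); rewrite ltr_pdivrMr// mul1r ltrDr.
have beta0 : 0 < 1 - alpha by rewrite subr_gt0.
have K0 : 0 < C'' / (1 - alpha) by rewrite divr_gt0.
(* Twice this exponent is delta - alpha (2 + delta). *)
have expo0 : 0 < (1 - alpha) * (1 + delta / 2) - 1.
  have : alpha * (2 + delta) < delta by rewrite -ltr_pdivlMr.
  lra.
(* The pathwise bounds hold surely, so the exceptional events in (A1) and (A3) are empty for large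
   T. *)
have empty_cvg (A : nat -> set Omega) :
    (\forall T \near \oo, A T = set0) -> (fun T => Pr (A T)) @ \oo --> 0%E.
  move=> A0; apply: cvg_near_cst; near=> T.
  by rewrite (_ : A T = set0) ?measure0//; near: T.
have lamlt T x t : (1 <= t < T)%N -> lam T t x < 1 by exact: lam_lt1.
have gpos T x t : (1 <= t <= T)%N -> 0 < g t x by case/andP => t1 _; exact: g_gt0.
have lam_ge T x t : (1 <= t <= T)%N -> 1 / (1 + T - t)%N%:R <= lam T t x.
  by move=> tT; have [] := lam_bounds T t x tT.
have lam_le T x t : (1 <= t <= T)%N -> lam T t x <= C'' * (g t x)^-1 /
    (t%:R `^ (- alpha) + T%:R `^ (1 - alpha) - t%:R `^ (1 - alpha)).
  by move=> tT; have [] := lam_bounds T t x tT.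
split; last split.
- move=> M; apply: empty_cvg; near=> T.
  have T0 : (0 < T)%N by near: T; exact: nbhs_infty_gt.
  apply/seteqP; split => // x /=; rewrite D1// divr1 leNgt => /negP; apply.
  apply: (@lt_le_trans _ _ (T%:R `^ (1 - alpha) / (C'' / (1 - alpha)))).
    (* The added 1 gives strictness, as [powR_pinfty] yields only a weak inequality. *)
    rewrite ltr_pdivlMr// (@lt_le_trans _ _ (M * (C'' / (1 - alpha)) + 1))//.
      by rewrite ltrDl.
    by near: T; exact: powR_pinfty.
  exact: (sum_sqrt_weights_ge T0 alpha0 alpha1 C''0 (@gpos T x) (@lamlt T x)
    (lam_last T x T0) (@lam_ge T x) (@lam_le T x) (fun t => @h_ge0 T t x)
    (fun t => @hE T t x)).
(* For T >= 1 the ratio is identically 1, so any exponent p > 1 would serve. *)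
- exists 2; split; first by rewrite ltr1n.
  apply: cvg_near_cst; near=> T.
  have T0 : (0 < T)%N by near: T; exact: nbhs_infty_gt.
  rewrite D1//; apply: integral0_eq => x _.
  rewrite (sum_weights_eq1 T0 (lam_last T x T0) (fun t => @hE T t x)).
  by rewrite divr1 subrr normr0 powR0// pnatr_eq0.
- move=> eps eps0; apply: empty_cvg; near=> T.
  have T0 : (0 < T)%N by near: T; exact: nbhs_infty_gt.
  apply/seteqP; split => // x /=; rewrite D1// powR1 divr1 subr0.
  rewrite leNgt => /negP; apply.
  rewrite ger0_norm; last first.
    rewrite sumr_ge0// => t _; rewrite mulr_ge0 ?powR_ge0// fine_ge0//.
    by apply: integral_ge0 => w _; rewrite lee_fin powR_ge0.
  have m_le t : (1 <= t <= T)%N ->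
      fine (Ecm (P t x) (fun w => `|gamma t x w| `^ (2 + delta))) <=
      C * g t x `^ (2 + delta).
    case/andP => t1 _; have := moment_le t x t1.
    set E := Ecm _ _ => Ele.
    (* Nonnegativity and the moment bound make E finite, so [fine] preserves the inequality. *)
    have E0 : (0 <= E)%E by apply: integral_ge0 => w _; rewrite lee_fin powR_ge0.
    rewrite -lee_fin fineK// ge0_fin_numE//.
    exact: le_lt_trans Ele (ltry _).
  have := sum_weighted_moments_le T0 alpha0 alpha1 C''0 (@gpos T x) (@lamlt T x)
    (@lam_ge T x) (@lam_le T x) (fun t => @h_ge0 T t x) (fun t => @hE T t x)
    (ltW delta0) (ltW C0) m_le.
  move=> /le_lt_trans; apply.
  rewrite ltr_pdivrMr ?powR_gt0 ?ltr0n// -ltr_pdivrMl//.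
  rewrite (@lt_le_trans _ _ (eps^-1 *
    (C * (C'' / (1 - alpha)) `^ (1 + delta / 2)) + 1))// ?ltrDl//.
  by near: T; exact: powR_pinfty.
Unshelve. all: by end_near.
Qed.
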